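(* Let $Y$ be a finite CW complex (with a geodesic metric) and let $\widetilde Y$ be its universal cover with the lifted metric. Then \[ \dim_{mc}\widetilde Y\le\dim_{MC}\widetilde Y\le\operatorname{cat}(Y). \]
   Context: $\operatorname{cat}(Y)$ is the normalized Lusternik–Schnirelmann category: the smallest $k$ such that $Y$ is covered by $k+1$ open sets contractible in $Y$. A map $f:X\to Z$ of metric spaces is uniformly cobounded if there is $C>0$ with $\operatorname{diam} f^{-1}(z)<C$ for all $z$. $\dim_{mc}X$ is the smallest $k$ such that there is a uniformly cobounded continuous map from $X$ to a $k$-dimensional simplicial complex; $\dim_{MC}X$ is the smallest $k$ such that there is a Lipschitz uniformly cobounded proper map from $X$ to a $k$-dimensional simplicial complex with a uniform metric. *)

(* Defs.v *)
From HB Require Import structures.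
From mathcomp Require Import all_boot all_order all_algebra finmap.
From mathcomp Require Import all_classical all_reals all_analysis.
Set Implicit Arguments. Unset Strict Implicit. Unset Printing Implicit Defensive.
Import Order.TTheory GRing.Theory Num.Theory.
Import numFieldNormedType.Exports.
Local Open Scope classical_set_scope.
Local Open Scope ring_scope.

Section Defs.
Context {R : realType}.

Definition unitI : set R := [set t | 0 <= t <= 1].

Definition sqnorm n (v : 'rV[R]_n) : R := \sum_(i < n) (v ord0 i) ^+ 2.
Definition cdisk n : set 'rV[R]_n := [set v | sqnorm v <= 1].
Definition odisk n : set 'rV[R]_n := [set v | sqnorm v < 1].
Definition sphere n : set 'rV[R]_n := [set v | sqnorm v = 1].
Arguments cdisk : clear implicits.
Arguments odisk : clear implicits.
Arguments sphere : clear implicits.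

(* X is a finite CW complex: finitely many cells i : 'I_m of dimension dm i,
   with characteristic maps Phi i : D^(dm i) -> X, such that the open cells
   Phi i (int D) partition X, each Phi i is a homeomorphism from int D onto
   its open cell, and the boundary sphere is mapped into cells of lower
   dimension.  (Closure-finiteness and the weak topology are automatic for
   finitely many cells in a Hausdorff space.) *)
Definition finite_CW (X : topologicalType) : Prop :=
  hausdorff_space X /\
  exists (m : nat) (dm : 'I_m -> nat) (Phi : forall i : 'I_m, 'rV[R]_(dm i) -> X),
    (forall i, {within cdisk (dm i), continuous (Phi i)}) /\
    (forall i v w, odisk _ v -> odisk _ w -> Phi i v = Phi i w -> v = w) /\
    (forall i (A : set 'rV[R]_(dm i)), open A -> A `<=` odisk (dm i) ->
       exists O : set X, open O /\ Phi i @` A = O `&` Phi i @` odisk (dm i)) /\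
    (forall x : X, exists i, (Phi i @` odisk (dm i)) x) /\
    (forall i j x, (Phi i @` odisk (dm i)) x -> (Phi j @` odisk (dm j)) x -> i = j) /\
    (forall i v, sphere _ v -> exists j, (dm j < dm i)%N /\
       (Phi j @` odisk (dm j)) (Phi i v)).

Definition geodesic (Y : metricType R) : Prop :=
  forall x y : Y, exists g : R -> Y, g 0 = x /\ g (mdist x y) = y /\
    forall s t, 0 <= s <= mdist x y -> 0 <= t <= mdist x y ->
      mdist (g s) (g t) = `|s - t|.

Definition is_path (T : topologicalType) (g : R -> T) (a b : T) : Prop :=
  {within unitI, continuous g} /\ g 0 = a /\ g 1 = b.

Definition path_connected (T : topologicalType) : Prop :=
  forall a b : T, exists g : R -> T, is_path g a b.

Definition simply_connected (T : topologicalType) : Prop :=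
  path_connected T /\
  forall (a : T) (g : R -> T), is_path g a a ->
    exists H : R * R -> T, {within unitI `*` unitI, continuous H} /\
      (forall s, unitI s -> H (s, 0) = g s /\ H (s, 1) = a) /\
      (forall t, unitI t -> H (0, t) = a /\ H (1, t) = a).

Definition evenly_covered (E B : topologicalType) (p : E -> B) (U : set B) : Prop :=
  exists (J : Type) (W : J -> set E),
    (forall j, open (W j)) /\
    p @^-1` U = \bigcup_(j in setT) W j /\
    (forall i j, i <> j -> W i `&` W j = set0) /\
    (forall j, p @` W j = U /\
       (forall a b, W j a -> W j b -> p a = p b -> a = b) /\
       (forall A, A `<=` W j -> open A -> open (p @` A))).

Definition covering_map (E B : topologicalType) (p : E -> B) : Prop :=
  continuous p /\ (forall y, exists a, p a = y) /\
  forall y, exists U, open U /\ U y /\ evenly_covered p U.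

Definition universal_cover (E B : topologicalType) (p : E -> B) : Prop :=
  covering_map p /\ simply_connected E.

Definition path_length (Y : metricType R) (c : R -> Y) : \bar R :=
  ereal_sup [set z | exists (n : nat) (t : nat -> R),
    t 0%N = 0 /\ t n = 1 /\ (forall i, t i <= t i.+1) /\
    z = (\sum_(i < n) mdist (c (t i)) (c (t i.+1)))%:E].

Definition lifted_dist (E : topologicalType) (Y : metricType R) (p : E -> Y)
  (a b : E) : \bar R :=
  ereal_inf [set z | exists g : R -> E, is_path g a b /\ z = path_length (p \o g)].

Definition contractible_in (Y : topologicalType) (U : set Y) : Prop :=
  exists (H : Y * R -> Y) (y0 : Y), {within U `*` unitI, continuous H} /\
    forall x, U x -> H (x, 0) = x /\ H (x, 1) = y0.

Definition cat_le (Y : topologicalType) (k : nat) : Prop :=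
  exists U : 'I_k.+1 -> set Y,
    (forall i, open (U i)) /\ (forall i, contractible_in (U i)) /\
    (forall y, exists i, U i y).

Definition simplicial_complex (V : choiceType) (S : set {fset V}) : Prop :=
  (forall s, S s -> s != fset0) /\
  (forall s t, S s -> (t `<=` s)%fset -> t != fset0 -> S t).

Definition sc_dim_le (V : choiceType) (S : set {fset V}) (k : nat) : Prop :=
  forall s, S s -> (#|` s| <= k.+1)%N.

(* geometric realization: barycentric coordinate functions *)
Definition realization (V : choiceType) (S : set {fset V}) : set (V -> R) :=
  [set x | (forall v, 0 <= x v) /\ exists s, S s /\
     (forall v, x v != 0 -> v \in s) /\ \sum_(v <- enum_fset s) x v = 1].

(* uniform metric: restriction of the l2 distance of l2(V) *)
Definition l2dist (V : choiceType) (x y : V -> R) : R :=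
  sup [set r | exists F : {fset V},
    r = Num.sqrt (\sum_(v <- enum_fset F) (x v - y v) ^+ 2)].

Definition K_continuous (T : topologicalType) (V : choiceType) (f : T -> V -> R) : Prop :=
  forall a e, 0 < e -> \forall b \near a, l2dist (f a) (f b) < e.

(* (sequential = topological, in a metric space) compactness in |S| *)
Definition K_compact (V : choiceType) (S : set {fset V}) (C : set (V -> R)) : Prop :=
  C `<=` realization S /\
  forall u : nat -> V -> R, (forall n, C (u n)) ->
    exists (phi : nat -> nat) (x : V -> R), (forall n, (phi n < phi n.+1)%N) /\ C x /\
      forall e, 0 < e -> exists N, forall n, (N <= n)%N -> l2dist (u (phi n)) x < e.

Definition diam (E : Type) (d : E -> E -> \bar R) (A : set E) : \bar R :=
  ereal_sup [set z | exists a b, A a /\ A b /\ z = d a b].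

Definition unif_cobounded (E Z : Type) (d : E -> E -> \bar R) (f : E -> Z) : Prop :=
  exists C : R, 0 < C /\ forall z, (diam d (f @^-1` [set z]) < C%:E)%E.

Definition dim_mc_le (E : topologicalType) (d : E -> E -> \bar R) (k : nat) : Prop :=
  exists (V : choiceType) (S : set {fset V}) (f : E -> V -> R),
    simplicial_complex S /\ sc_dim_le S k /\ (forall a, realization S (f a)) /\
    K_continuous f /\ unif_cobounded d f.

Definition dim_MC_le (E : topologicalType) (d : E -> E -> \bar R) (k : nat) : Prop :=
  exists (V : choiceType) (S : set {fset V}) (f : E -> V -> R),
    simplicial_complex S /\ sc_dim_le S k /\ (forall a, realization S (f a)) /\
    K_continuous f /\ unif_cobounded d f /\
    (exists L : R, 0 <= L /\ forall a b, ((l2dist (f a) (f b))%:E <= L%:E * d a b)%E) /\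
    (forall C, K_compact S C -> compact (f @^-1` C)).

End Defs.

(* Main.v *)
(** A contraction of [U i] in [Y] lifts to the universal cover: the track of a point
    [p a] in [U i], lifted from [a], ends at a point [z] of the fibre over the point
    to which [U i] is contracted, and [z] is locally constant in [a].  The sets of
    points ending at a given [z] are copies of [U i], of bounded diameter after
    shrinking, and weighting them by a Lipschitz partition of unity [psi] of [Y]
    gives the map [a |-> \sum_i psi i (p a) (i, z_i(a))] to a complex of
    dimension [k].

    Continuous path lifting is avoided.  The metric of [Y] being geodesic, [Y] compact,
    there is a scale [e] below which [p] is an isometry on balls for the lifted
    distance; the tracks are sampled at finitely many times with steps shorter than
    [e], and the samples are lifted one by one. *)
Require Import Defs.
From HB Require Import structures.
From mathcomp Require Import all_boot all_order all_algebra finmap.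
From mathcomp Require Import all_classical all_reals all_analysis.
From mathcomp Require Import ring lra.
Set Implicit Arguments. Unset Strict Implicit. Unset Printing Implicit Defensive.
Import Order.TTheory GRing.Theory Num.Theory.
Import numFieldNormedType.Exports.
Local Open Scope classical_set_scope.
Local Open Scope ring_scope.

(** * Lebesgue numbers and lengths of paths *)

Section MetricGeneralities.
Context {R : realType} {Y : metricType R}.

Lemma open_mball (U : set Y) (x : Y) : open U -> U x ->
  exists r : R, 0 < r /\ forall y, mdist x y < r -> U y.
Proof.
move=> oU Ux; have /metricType_numDomainType.nbhs_mdistP[r r0 sub] : \near x, U x.
  by exact: open_nbhs_nbhs.
by exists r; split.
Qed.

Lemma nbhs_mball (x : Y) (r : R) : 0 < r -> \forall y \near x, mdist x y < r.
Proof. by move=> r0; apply/metricType_numDomainType.nbhs_mdistP; exists r. Qed.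

Lemma continuous_lipschitz (f : Y -> R) (L : R) :
  (forall x y, `|f x - f y| <= L * mdist x y) -> continuous f.
Proof.
move=> fL x; apply/cvgrPdist_lt => e e0.
have L1 : 0 < `|L| + 1 by rewrite ltr_wpDl.
have := nbhs_mball x (divr_gt0 e0 L1); apply: filterS => y.
rewrite ltr_pdivlMr// => xy; apply: le_lt_trans (fL _ _) _; apply: le_lt_trans xy.
rewrite mulrC ler_wpM2l// ?mdist_ge0//; have := ler_norm L; lra.
Qed.

Lemma lebesgue_number (I : Type) (U : I -> set Y) : compact [set: Y] ->
  (forall i, open (U i)) -> (forall y, exists i, U i y) ->
  exists r : R, 0 < r /\ forall y, exists i, forall z, mdist y z < r -> U i z.
Proof.
move=> /compact_near_coveringP cY oU covU.
have := cY R (0^'+) (fun r y => exists i, forall z, mdist y z < r -> U i z) _.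
move=> near_r; suff : \forall r \near (0 : R)^'+, 0 < r /\
    ([set: Y] `<=` fun y => exists i, forall z, mdist y z < r -> U i z).
  move=> /filter_ex [r [r0 rP]]; exists r; split => // y; exact: rP.
apply: filterI; first exact: nbhs_right_gt.
apply: near_r => y _; have [i Uiy] := covU y.
have [r [r0 rU]] := open_mball (oU i) Uiy.
(* Halving the radius leaves room for the centre to move: the [r / 2]-ball about any [y'] within
   [r / 2] of [y] still lies in [U i]. *)
have r2 : 0 < r / 2 by rewrite divr_gt0.
exists ([set y' | mdist y y' < r / 2], [set s | s < r / 2]) => /=.
  split; first exact: nbhs_mball. exact: nbhs_right_lt.
move=> [y' s] /= [yy' sr]; exists i => z y'z; apply: rU.
apply: le_lt_trans (metric_triangle _ y' _) _; lra.
Qed.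

End MetricGeneralities.

Section Paths.
Context {R : realType}.
Implicit Type T : topologicalType.

Local Notation unitI := (@unitI R).

Lemma unitIE : unitI = `[0, 1]%classic.
Proof. by apply/seteqP; split => t; rewrite /= in_itv. Qed.

Lemma is_path_cst T (a : T) : is_path (fun _ : R => a) a a.
Proof. by split; [apply: continuous_subspaceT => x; exact: cvg_cst|]. Qed.

Lemma within_comp_unitI T (g : R -> T) (h : R -> R) (A : set R) :
  {within unitI, continuous g} -> continuous h -> (forall t, A t -> unitI (h t)) ->
  {within A, continuous (g \o h)}.
Proof.
move=> /subspace_continuousP cg ch hA; apply/subspace_continuousP => x Ax.
move=> W /(cg _ (hA _ Ax)) /= WW.
change (nbhs x (fun t => A t -> W (g (h t)))).
have HW : nbhs x (h @^-1` (fun t => unitI t -> W (g t))) := ch x _ WW.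
by apply: filterS HW => t tW At; exact: (tW (hA _ At)).
Qed.

Lemma is_path_rev T (g : R -> T) a b : is_path g a b -> is_path (g \o (fun t => 1 - t)) b a.
Proof.
move=> [cg [g0 g1]]; split; last by rewrite /= subr0 subrr.
apply: within_comp_unitI cg _ _; last by move=> t; rewrite /Defs.unitI /=; lra.
by move=> x; apply: cvgB; [exact: cvg_cst|exact: cvg_id].
Qed.

Definition path_concat T (g h : R -> T) : R -> T :=
  fun t => if t <= 2^-1 then g (2 * t) else h (2 * t - 1).

Lemma is_path_concat T (g h : R -> T) a b c :
  is_path g a b -> is_path h b c -> is_path (path_concat g h) a c.
Proof.
move=> [cg [g0 g1]] [ch [h0 h1]].
split; last first.
  rewrite /path_concat ifT; last by rewrite invr_ge0.
  rewrite mulr0 ifF; last by apply/negbTE; rewrite -ltNge; lra.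
  by rewrite mulr1; split => //; rewrite -h1; congr h; lra.
pose A := [set t : R | 0 <= t <= 2^-1]; pose B := [set t : R | 2^-1 <= t <= 1].
have AE : A = `[0, 2^-1]%classic by apply/seteqP; split => t; rewrite /= in_itv.
have BE : B = `[2^-1, 1]%classic by apply/seteqP; split => t; rewrite /= in_itv.
have -> : unitI = A `|` B.
  apply/seteqP; split => t; rewrite /A /B /Defs.unitI /=.
    by move=> t01; have [th|th] := leP t 2^-1; [left|right]; lra.
  by move=> [] ?; lra.
apply: withinU_continuous; rewrite ?AE ?BE; try exact: interval_closed.
- rewrite -AE; apply: (@subspace_eq_continuous _ _ _ (g \o (fun t => 2 * t))).
    by move=> t; rewrite inE => tA; rewrite /from_subspace /path_concat /= ifT//; case/andP: tA.
  apply: within_comp_unitI cg _ _; last by move=> t; rewrite /A /Defs.unitI /=; lra.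
  by move=> x; apply: cvgM; [exact: cvg_cst|exact: cvg_id].
- rewrite -BE; apply: (@subspace_eq_continuous _ _ _ (h \o (fun t => 2 * t - 1))).
    move=> t; rewrite inE => tB; rewrite /from_subspace /path_concat /=; case: ifPn => // th.
    have -> : t = 2^-1 by move: tB; rewrite /B /=; lra.
    by rewrite mulfV// subrr h0 g1.
  apply: within_comp_unitI ch _ _; last by move=> t; rewrite /B /Defs.unitI /=; lra.
  move=> x; apply: cvgB; last exact: cvg_cst.
  by apply: cvgM; [exact: cvg_cst|exact: cvg_id].
Qed.

Section PathLength.
Context {Y : metricType R}.
Implicit Types c : R -> Y.

Lemma ge_path_length c (M : \bar R) :
  (forall (n : nat) (t : nat -> R), t 0%N = 0 -> t n = 1 ->
    {homo t : i j / (i <= j)%N >-> i <= j} ->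
    ((\sum_(i < n) mdist (c (t i)) (c (t i.+1)))%:E <= M)%E) ->
  (path_length c <= M)%E.
Proof.
move=> H; apply: ge_ereal_sup => _ [n [t [t0 [t1 [tm ->]]]]]; apply: H => //.
by apply: homo_leq tm => //; exact: le_trans.
Qed.

Lemma path_length_ge c (n : nat) (t : nat -> R) : t 0%N = 0 -> t n = 1 ->
    (forall i, t i <= t i.+1) ->
  ((\sum_(i < n) mdist (c (t i)) (c (t i.+1)))%:E <= path_length c)%E.
Proof. by move=> t0 t1 tm; apply: ereal_sup_ubound; exists n, t. Qed.

Lemma path_length_dist c (s : R) : unitI s ->
  ((mdist (c 0) (c s))%:E <= path_length c)%E.
Proof.
(* The subdivision [0, s, 1], constant from then on. *)
move=> /andP[s0 s1]; pose t (i : nat) : R := if i is j.+1 then if j is 0%N then s else 1 else 0.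
apply: le_trans (@path_length_ge c 2 t _ _ _) => //.
  by rewrite lee_fin !big_ord_recl big_ord0 /= addr0 lerDl mdist_ge0.
by case=> [|[|i]].
Qed.

Lemma path_length_cst (y : Y) : (path_length (fun=> y) <= 0)%E.
Proof.
apply: ge_path_length => n t _ _ _; rewrite big1 // => i _; exact: mdistxx.
Qed.

Lemma path_length_rev c : (path_length (c \o (fun t => 1 - t)%R) <= path_length c)%E.
Proof.
apply: ge_path_length => n t t0 t1 tm.
have := @path_length_ge c n (fun i => 1 - t (n - i)%N).
rewrite subn0 subnn t0 t1 subrr subr0 => /(_ erefl erefl) H.
apply: le_trans (H _); last by move=> i; rewrite lerB// tm// leq_sub2l.
rewrite lee_fin (reindex_inj rev_ord_inj) /=.
apply: ler_sum => i _; rewrite metric_sym; have lin := ltn_ord i.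
by rewrite subnSK// subKn 1?ltnW// ler_eqVlt eqxx.
Qed.

(** A subdivision [t] of the concatenation is clamped to each half and rescaled, giving subdivisions
    [u] of [c] and [v] of [c']. Steps inside one half are kept, and a step across [1/2] is split at
    the common point by the triangle inequality. *)
Lemma path_length_concat c c' : c 1 = c' 0 ->
  (path_length (path_concat c c') <= path_length c + path_length c')%E.
Proof.
move=> cc'; apply: ge_path_length => n t t0 t1 tm.
pose u i := Num.min 1 (2 * t i); pose v i := Num.max 0 (2 * t i - 1).
have um i : u i <= u i.+1.
  by rewrite /u le_min ge_min lexx /= ge_min; apply/orP; right; have := tm i i.+1 (leqnSn _); lra.
have vm i : v i <= v i.+1.
  by rewrite /v ge_max le_max lexx /= le_max; apply/orP; right; have := tm i i.+1 (leqnSn _); lra.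
apply: le_trans (leeD (@path_length_ge c n u _ _ um) (@path_length_ge c' n v _ _ vm)).
- rewrite -EFinD lee_fin -big_split /=; apply: ler_sum => i _.
  have tt := tm i i.+1 (leqnSn _); rewrite /path_concat /u /v.
  case: ifPn => ti; case: ifPn => ti1.
  + rewrite !min_r; [|lra|lra]; rewrite lerDl; exact: mdist_ge0.
  + rewrite min_r; last lra; rewrite min_l; last lra.
    rewrite max_l; last lra; rewrite max_r; last lra.
    by rewrite cc'; exact: metric_triangle.
  + lra.
  + rewrite !max_r; [|lra|lra]; rewrite lerDr; exact: mdist_ge0.
- by rewrite /u t0 mulr0 min_r.
- by rewrite /u t1 mulr1 min_l // ler1n.
- by rewrite /v t0 mulr0 max_l //; lra.
- rewrite /v t1 mulr1 max_r //; lra.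
Qed.

Lemma path_length_speed c (L : R) :
  (forall s t, 0 <= s <= 1 -> 0 <= t <= 1 -> mdist (c s) (c t) = L * `|s - t|) ->
  (path_length c <= L%:E)%E.
Proof.
move=> cL; apply: ge_path_length => n t t0 t1 tm.
have t01 i : (i <= n)%N -> 0 <= t i <= 1.
  by move=> ni; rewrite -t0 -t1 !tm.
rewrite lee_fin (eq_bigr (fun i : 'I_n => L * (t i.+1 - t i))).
  rewrite -mulr_sumr -(big_mkord xpredT (fun i => t i.+1 - t i)) telescope_sumr//.
  by rewrite t0 t1 subr0 mulr1.
move=> i _; rewrite cL; [|exact/t01/ltnW|exact/t01].
by rewrite distrC ger0_norm// subr_ge0 tm.
Qed.

End PathLength.
End Paths.

(** * The lifted distance of a covering *)

Section LiftedDist.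
Context {R : realType} {Y : metricType R} {E : topologicalType} (p : E -> Y).
Local Notation D := (lifted_dist p).

Lemma lifted_dist_le_path (g : R -> E) a b :
  is_path g a b -> (D a b <= path_length (p \o g))%E.
Proof. by move=> gab; apply: ereal_inf_lbound; exists g. Qed.

(** The infimum need not be attained, so estimates are mostly carried as strict bounds, each of
    which yields an actual path. *)
Lemma lifted_dist_lt_path a b (r : \bar R) : (D a b < r)%E ->
  exists g : R -> E, is_path g a b /\ (path_length (p \o g) < r)%E.
Proof. by move=> /ereal_inf_lt[_ [g [gab ->]] lt]; exists g. Qed.

Lemma lifted_dist_refl a (r : R) : 0 < r -> (D a a < r%:E)%E.
Proof.
move=> r0; apply: le_lt_trans (lifted_dist_le_path (is_path_cst a)) _.
by apply: le_lt_trans (path_length_cst _) _; rewrite lte_fin.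
Qed.

Lemma lifted_dist_sym a b (r : R) : (D a b < r%:E)%E -> (D b a < r%:E)%E.
Proof.
move=> /lifted_dist_lt_path[g [gab lt]].
apply: le_lt_trans (lifted_dist_le_path (is_path_rev gab)) _.
exact: le_lt_trans (path_length_rev _) lt.
Qed.

Lemma lifted_dist_triangle b a c (r s : R) :
  (D a b < r%:E)%E -> (D b c < s%:E)%E -> (D a c < (r + s)%:E)%E.
Proof.
move=> /lifted_dist_lt_path[g [gab ltg]] /lifted_dist_lt_path[h [hbc lth]].
apply: le_lt_trans (lifted_dist_le_path (is_path_concat gab hbc)) _.
have -> : p \o path_concat g h = path_concat (p \o g) (p \o h).
  by apply/funext => t; rewrite /path_concat /=; case: ifP.
apply: le_lt_trans (path_length_concat _) _.
  by case: gab => _ [_ /= ->]; case: hbc => _ [->].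
by rewrite EFinD lteD.
Qed.

Lemma mdist_le_lifted_dist a b : ((mdist (p a) (p b))%:E <= D a b)%E.
Proof.
apply: le_ereal_inf_tmp => _ [g [[_ [<- <-]] ->]].
by apply: (@path_length_dist _ _ (p \o g)); rewrite /unitI /= lexx ler01.
Qed.

Lemma lifted_dist_mdist a b (r : R) : (D a b < r%:E)%E -> mdist (p a) (p b) < r.
Proof. by move=> lt; rewrite -lte_fin; exact: le_lt_trans (mdist_le_lifted_dist _ _) lt. Qed.

Definition sheet (W : set E) : Prop :=
  open W /\ (forall a b, W a -> W b -> p a = p b -> a = b) /\
  (forall A, A `<=` W -> open A -> open (p @` A)).

(** A geodesic from [p a] to [y] stays in the [r]-ball about [p a], hence over the sheet, where the
    inverse of [p] lifts it. The lift has the length of the geodesic, which is the distance. *)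
Lemma sheet_geodesic_lift (W : set E) a (y : Y) (r : R) : geodesic Y ->
  sheet W -> W a -> (forall z, mdist (p a) z < r -> (p @` W) z) -> mdist (p a) y < r ->
  exists b, W b /\ p b = y /\ (D a b <= (mdist (p a) y)%:E)%E.
Proof.
move=> geo [oW [injW openW]] Wa covW; set L := mdist (p a) y => Lr.
have [g [g0 [gL giso]]] := geo (p a) y; rewrite -/L in gL giso.
have L0 : 0 <= L := mdist_ge0 _ _.
pose c (t : R) := g (L * t).
have cI t : 0 <= t <= 1 -> 0 <= L * t <= L.
  by move=> /andP[t0 t1]; rewrite mulr_ge0//= ler_piMr.
have cspeed s t : 0 <= s <= 1 -> 0 <= t <= 1 -> mdist (c s) (c t) = L * `|s - t|.
  by move=> /cI sI /cI tI; rewrite giso// -mulrBr normrM ger0_norm.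
have c0 : c 0 = p a by rewrite /c mulr0.
have c1 : c 1 = y by rewrite /c mulr1.
(* The implication sits under the existential so that choice gives a total [h]; outside the unit
   interval the value is arbitrary. *)
have cW t : exists w, 0 <= t <= 1 -> W w /\ p w = c t.
  have [t01|] := boolP (0 <= t <= 1); last by exists a.
  have [|w Ww pw] := covW (c t); last by exists w.
  rewrite -c0 cspeed ?lexx ?ler01// sub0r normrN.
  apply: le_lt_trans Lr; rewrite ler_piMr// ger0_norm; lra.
have /choice [h hP] := cW.
have h0 : h 0 = a.
  by have [|Wh ph] := hP 0; rewrite ?lexx ?ler01//; apply: injW; rewrite // ph.
have h1 : p (h 1) = y by have [|Wh ->] := hP 1; rewrite ?lexx ?ler01.
have hpath : is_path h a (h 1).
  split => //; apply/subspace_continuousP => t tI A /=.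
  rewrite nbhsE /= => -[G [oG Gt] GA].
  change (nbhs t (fun s => unitI s -> A (h s))).
  have [Wht pht] := hP t tI.
  (* Continuity of [h] at [t]: a ball about [p (h t)] is covered by [G] intersected with [W], and
     injectivity on [W] forces the nearby [h u] into [G]. The radius is divided by [L + 1] since [L]
     may vanish. *)
  have [s [s0 sO]] : exists s : R, 0 < s /\
      forall z, mdist (p (h t)) z < s -> (p @` (G `&` W)) z.
    apply: open_mball; last by exists (h t).
    by apply: openW; [move=> ? [] | exact: openI].
  have L1 : 0 < L + 1 by rewrite ltr_wpDl.
  exists (s / (L + 1)) => /=; first by rewrite divr_gt0.
  move=> u /= tu uI; have [Whu phu] := hP u uI.
  have [|v [Gv Wv] pv] := sO (p (h u)).
    rewrite pht phu cspeed//; move: tu; rewrite ltr_pdivlMr// => tu.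
    apply: le_lt_trans tu; rewrite mulrC ler_wpM2l//; lra.
  by apply: GA; rewrite -(injW _ _ Wv Whu pv).
exists (h 1); split; first by have [|] := hP 1; rewrite ?lexx ?ler01.
split => //; apply: le_trans (lifted_dist_le_path hpath) _.
apply: path_length_speed => s t sI tI; rewrite /=.
by rewrite (hP s sI).2 (hP t tI).2 cspeed.
Qed.

(** The disjoint open sheets over [U] cut the time line into disjoint open sets, so the times spent
    in [W j] form a clopen set, which is everything by connectedness. *)
Lemma path_stays_in_sheet (U : set Y) (J : Type) (W : J -> set E) (j : J) (g : R -> E) a b :
  (forall i, open (W i)) -> p @^-1` U = \bigcup_(i in setT) W i ->
  (forall i i', i <> i' -> W i `&` W i' = set0) ->
  is_path g a b -> (forall t, unitI t -> U (p (g t))) -> W j a -> W j b.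
Proof.
move=> oW UW disj [cg [g0 g1]] gU Wa.
(* Clamping time extends the path continuously to all of [R], where connectedness is applied. *)
pose clamp (t : R) := Num.max 0 (Num.min 1 t).
have clampI t : unitI (clamp t).
  rewrite /unitI /clamp /= le_max lexx /= ge_max ler01 /= ge_min lexx //.
have clampc : continuous clamp.
  have cst1 (c : R) : continuous (fun _ : R => c) by move=> ?; exact: cvg_cst.
  move=> t; have : {for t,
      continuous ((fun _ : R => 0 : R^o) \max ((fun _ : R => 1 : R^o) \min id))}.
    apply: continuous_max; first exact: cst1.
    by apply: continuous_min; [exact: cst1|exact: cvg_id].
  by [].
have cgc : continuous (g \o clamp).
  apply/continuous_subspace_setT.
  exact: (@within_comp_unitI _ _ g clamp setT cg clampc (fun t _ => clampI t)).
have clampid t : unitI t -> clamp t = t.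
  by rewrite /unitI /clamp /= => /andP[t0 t1]; rewrite min_r// max_r.
have /clopen_connectedP H : connected [set: R] by apply/connected_intervalP.
suff : [set: R] `<=` (g \o clamp) @^-1` (W j).
  move=> /(_ 1 I) /=; rewrite clampid ?g1 // /unitI /=; by rewrite ler01 lexx.
rewrite (_ : _ @^-1` _ = setT)//; apply: H => //; last first.
  exists 0; rewrite /= clampid ?g0// /unitI /=; by rewrite ler01 lexx.
have oj i : open ((g \o clamp) @^-1` W i) by apply: open_comp => // ? _; exact: cgc.
have cj : closed ((g \o clamp) @^-1` W j).
  rewrite -[X in closed X]setCK; apply: open_closedC.
  rewrite (_ : ~` _ = \bigcup_(i in [set i | i <> j]) ((g \o clamp) @^-1` W i));
    first exact: bigcup_open.
  apply/seteqP; split => t /=.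
    move=> nW; have : (p @^-1` U) (g (clamp t)) by apply: gU.
    rewrite UW => -[i _ Wi]; exists i => //= ij; by apply: nW; rewrite -ij.
  move=> [i /= ij Wi] Wj; suff : (W i `&` W j) (g (clamp t)) by rewrite disj.
  by split.
split; [exact: open_subspaceW|exact: closed_subspaceW].
Qed.

(** The radius is a Lebesgue number of the cover of [Y] by evenly covered sets. A path from [a]
    shorter than [r] projects into the [r]-ball about [p a], so it cannot leave the sheet of [a]. *)
Lemma covering_radius : compact [set: Y] -> covering_map p ->
  exists r : R, 0 < r /\ forall a, exists W, sheet W /\ W a /\
    (forall z, mdist (p a) z < r -> (p @` W) z) /\ (forall b, (D a b < r%:E)%E -> W b).
Proof.
move=> cY [_ [_ cov]]; have /choice [U UP] := cov.
have [r [r0 rP]] : exists r : R, 0 < r /\ forall y, exists i, forall z, mdist y z < r -> U i z.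
  apply: lebesgue_number => //; first by move=> i; case: (UP i).
  by move=> y; exists y; case: (UP y) => _ [].
exists r; split => // a; have [y yP] := rP (p a).
have [oU [_ [J [W [oW [UW [disj shW]]]]]]] := UP y.
have : (p @^-1` U y) a by apply: yP; rewrite mdistxx.
rewrite UW => -[j _ Wa]; have [pW [injW openW]] := shW j.
exists (W j); split; first by split.
split => //; split; first by move=> z /yP; rewrite pW.
move=> b /lifted_dist_lt_path[g [gab ltg]].
apply: (path_stays_in_sheet oW UW disj gab _ Wa) => t tI; apply: yP.
rewrite -lte_fin; apply: le_lt_trans ltg.
by have := @path_length_dist _ _ (p \o g) t tI; rewrite /= (proj1 (proj2 gab)).
Qed.

End LiftedDist.

(** * Lifting fine chains *)

Section ChainLifting.
Context {R : realType} {Y : metricType R} {E : topologicalType} (p : E -> Y).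
Local Notation D := (lifted_dist p).

(* Comparing the lifts of two nearby chains adds up four distances below [e]. *)
Definition lifting_scale (e : R) : Prop :=
  [/\ 0 < e,
      forall a y, mdist (p a) y < 4 * e ->
        exists b, p b = y /\ (D a b <= (mdist (p a) y)%:E)%E &
      forall a b, p a = p b -> (D a b < (4 * e)%:E)%E -> a = b].

(** A quarter of the covering radius works: short geodesics lift inside a sheet, and two points of a
    fibre at lifted distance below that radius share a sheet. *)
Lemma exists_lifting_scale : geodesic Y -> compact [set: Y] -> covering_map p ->
  exists e, lifting_scale e.
Proof.
move=> geo cY /(covering_radius cY) [r [r0 rP]].
exists (r / 4); have -> : lifting_scale (r / 4) = [/\ 0 < r / 4,
      forall a y, mdist (p a) y < r ->
        exists b, p b = y /\ (D a b <= (mdist (p a) y)%:E)%E &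
      forall a b, p a = p b -> (D a b < r%:E)%E -> a = b].
  by rewrite /lifting_scale; have -> : 4 * (r / 4) = r by lra.
split; first by rewrite divr_gt0.
  move=> a y ay; have [W [shW [Wa [Wr _]]]] := rP a.
  by have [b [_ Hb]] := sheet_geodesic_lift geo shW Wa Wr ay; exists b.
move=> a b ab Dab; have [W [[_ [injW _]] [Wa [_ Wr]]]] := rP a.
exact: injW (Wr _ Dab) ab.
Qed.

(** Together with [nbhs_lifted_ball], this identifies the topology of [E] with the one given by
    lifted balls. Near [a] the point [b] lies in the sheet of [a], so it is the end of a lifted
    geodesic. *)
Lemma lifted_ball_nbhs : geodesic Y -> compact [set: Y] -> covering_map p ->
  forall a (s : R), 0 < s -> \forall b \near a, (D a b < s%:E)%E.
Proof.
move=> geo cY cov a s s0; have [r [r0 rP]] := covering_radius cY cov.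
have [cp _] := cov.
have [W [shW [Wa [Wr _]]]] := rP a; have [oW [injW _]] := shW.
have m0 : 0 < Num.min r s by rewrite lt_min r0 s0.
have near1 : \forall b \near a, mdist (p a) (p b) < Num.min r s.
  exact: (cp a _ (nbhs_mball (p a) m0)).
have near2 : \forall b \near a, W b by exact: open_nbhs_nbhs.
apply: filterS2 near1 near2 => b; rewrite lt_min => /andP[abr abs] Wb.
have [c [Wc [pc Dac]]] := sheet_geodesic_lift geo shW Wa Wr abr.
by rewrite (injW _ _ Wb Wc (esym pc)); apply: le_lt_trans Dac _; rewrite lte_fin.
Qed.

Lemma nbhs_lifted_ball : geodesic Y -> compact [set: Y] -> covering_map p ->
  forall a (A : set E), nbhs a A -> exists s : R, 0 < s /\ forall b, (D a b < s%:E)%E -> A b.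
Proof.
move=> geo cY cov a A; rewrite nbhsE /= => -[G [oG Ga] GA].
have [r [r0 rP]] := covering_radius cY cov.
have [W [shW [Wa [Wr WD]]]] := rP a; have [oW [injW openW]] := shW.
have [s [s0 sG]] : exists s : R, 0 < s /\
    forall z, mdist (p a) z < s -> (p @` (G `&` W)) z.
  apply: open_mball; last by exists a.
  by apply: openW; [move=> ? [] | exact: openI].
exists (Num.min r s); split; first by rewrite lt_min r0 s0.
move=> b Dab; have Wb : W b.
  by apply: WD; apply: lt_le_trans Dab _; rewrite lee_fin ge_min lexx.
have [|c [Gc Wc] pc] := sG (p b).
  by have := lifted_dist_mdist Dab; rewrite lt_min => /andP[].
by apply: GA; rewrite -(injW _ _ Wc Wb pc).
Qed.

Context (e : R) (scale_e : lifting_scale e).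

Lemma scale_gt0 : 0 < e. Proof. by case: scale_e. Qed.

Lemma scale_lift a y (s : R) : mdist (p a) y < s -> s <= 4 * e ->
  exists b, p b = y /\ (D a b < s%:E)%E.
Proof.
have e0 := scale_gt0.
move=> ays se; have [_ ex _] := scale_e.
have [|b [pb Dab]] := ex a y; first lra.
by exists b; split => //; apply: le_lt_trans Dab _; rewrite lte_fin.
Qed.

Lemma scale_uniq a b (s : R) : p a = p b -> (D a b < s%:E)%E -> s <= 4 * e -> a = b.
Proof.
move=> pab Dab se; have [_ _ un] := scale_e; apply: un => //.
by apply: lt_le_trans Dab _; rewrite lee_fin.
Qed.

(** The default [a] is excluded by [lift_stepP] as soon as [y] is within [e] of [p a]. *)
Definition lift_step (a : E) (y : Y) : E := xget a [set b | p b = y /\ (D a b < e%:E)%E].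

(** The entry [ys 0] is never read; it is meant to be [p a]. *)
Fixpoint chain_lift (a : E) (ys : nat -> Y) (n : nat) : E :=
  if n is m.+1 then lift_step (chain_lift a ys m) (ys n) else a.

Lemma lift_stepP a y : mdist (p a) y < e ->
  p (lift_step a y) = y /\ (D a (lift_step a y) < e%:E)%E.
Proof.
have e0 := scale_gt0.
move=> aye; have [|b bP] := scale_lift aye; first by lra.
by rewrite /lift_step; case: xgetP => [? -> //|/(_ b)].
Qed.

Definition fine_chain (N : nat) (ys : nat -> Y) : Prop :=
  forall j, (j < N)%N -> mdist (ys j) (ys j.+1) < e.

Lemma chain_lift_fiber N a ys : fine_chain N ys -> ys 0%N = p a ->
  forall n, (n <= N)%N -> p (chain_lift a ys n) = ys n.
Proof.
move=> fine y0; elim=> [//|n IH] nN.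
by have [|-> //] := @lift_stepP (chain_lift a ys n) (ys n.+1); rewrite IH 1?ltnW// fine.
Qed.

Lemma chain_lift_step N a ys : fine_chain N ys -> ys 0%N = p a ->
  forall n, (n < N)%N -> (D (chain_lift a ys n) (chain_lift a ys n.+1) < e%:E)%E.
Proof.
move=> fine y0 n nN.
have [|//] := @lift_stepP (chain_lift a ys n) (ys n.+1).
by rewrite (chain_lift_fiber fine y0) 1?ltnW// fine.
Qed.

(** The factor is [n.+1] rather than [n] because the bound is strict already at [n = 0]. *)
Lemma chain_lift_dist N a ys : fine_chain N ys -> ys 0%N = p a ->
  forall n, (n <= N)%N -> (D a (chain_lift a ys n) < (n.+1%:R * e)%:E)%E.
Proof.
have e0 := scale_gt0.
move=> fine y0; elim=> [_|n IH nN].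
  by rewrite mul1r; exact: lifted_dist_refl.
rewrite -natr1 mulrDl mul1r.
apply: lifted_dist_triangle (IH (ltnW nN)) _; exact: (chain_lift_step fine y0).
Qed.

(** Two lifts that agree at [n] have their next points in one fibre and less than [2 * e] apart, so
    these coincide. *)
Lemma chain_lift_unique N ys (u : nat -> E) : fine_chain N ys ->
  (forall n, (n <= N)%N -> p (u n) = ys n) ->
  (forall n, (n < N)%N -> (D (u n) (u n.+1) < e%:E)%E) ->
  forall n, (n <= N)%N -> chain_lift (u 0%N) ys n = u n.
Proof.
have e0 := scale_gt0.
move=> fine pu Du; elim=> [//|n IH] nN; have IHn := IH (ltnW nN).
have y0 : ys 0%N = p (u 0%N) by rewrite pu.
apply: (@scale_uniq _ _ (e + e)); last lra.
  by rewrite (chain_lift_fiber fine y0)// pu.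
apply: (@lifted_dist_triangle _ _ _ _ (u n)); last exact: Du.
by apply: lifted_dist_sym; rewrite -IHn; exact: (chain_lift_step fine y0).
Qed.

(** The lift read backwards is a lift of the reversed chain, so uniqueness applies. *)
Lemma chain_lift_rev N a ys : fine_chain N ys -> ys 0%N = p a ->
  chain_lift (chain_lift a ys N) (fun j => ys (N - j)%N) N = a.
Proof.
move=> fine y0; pose u j := chain_lift a ys (N - j)%N.
have -> : chain_lift a ys N = u 0%N by rewrite /u subn0.
rewrite (@chain_lift_unique N _ u) ?leqnn//.
- by rewrite /u subnn.
- by move=> j jN; rewrite -(subnSK jN) metric_sym; apply: fine; rewrite subnSK// leq_subr.
- by move=> n nN; rewrite (chain_lift_fiber fine y0)// leq_subr.
- move=> n nN; apply: lifted_dist_sym; rewrite /u -(subnSK nN).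
  by apply: (chain_lift_step fine y0); rewrite subnSK// leq_subr.
Qed.

(** A discrete substitute for homotopy lifting: close chains with close starting points have close
    lifts. *)
Lemma chain_lift_close N a a' ys ys' :
  fine_chain N ys -> fine_chain N ys' -> ys 0%N = p a -> ys' 0%N = p a' ->
  (forall j, (j <= N)%N -> mdist (ys j) (ys' j) < e) -> (D a a' < e%:E)%E ->
  forall n, (n <= N)%N -> (D (chain_lift a ys n) (chain_lift a' ys' n) < e%:E)%E.
Proof.
have e0 := scale_gt0.
move=> fine fine' y0 y0' yy' Daa'; elim=> [//|n IH] nN; have IHn := IH (ltnW nN).
set b := chain_lift a ys n.+1; set b' := chain_lift a' ys' n.+1.
have pb : p b = ys n.+1 := chain_lift_fiber fine y0 nN.
have pb' : p b' = ys' n.+1 := chain_lift_fiber fine' y0' nN.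
have Dbb' : (D b b' < (e + e + e)%:E)%E.
  apply: lifted_dist_triangle (chain_lift_step fine' y0' nN).
  apply: lifted_dist_triangle IHn.
  by apply: lifted_dist_sym; exact: chain_lift_step fine y0 _ nN.
(* The bound [3 * e] is improved to [e]: the point [c] above [ys' n.+1] near [b] is within [4 * e]
   of [b'] in the same fibre, hence equals it. *)
have [c [pc Dbc]] : exists c, p c = ys' n.+1 /\ (D b c < e%:E)%E.
  by apply: scale_lift; [rewrite pb yy'|lra].
suff -> : b' = c by [].
apply: (@scale_uniq _ _ ((e + e + e) + e)); first by rewrite pc pb'.
  by apply: lifted_dist_triangle Dbc; exact: lifted_dist_sym.
by lra.
Qed.

(* A contraction of [C] in [Y], sampled at finitely many times so finely that
   its tracks lift to [E] step by step. *)
Definition sampled_contraction (C : set Y) (d : R) (N : nat) (T : Y -> nat -> Y) : Prop :=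
  [/\ forall y, C y -> T y 0%N = y,
      exists y0, forall y, C y -> T y N = y0,
      forall y, C y -> fine_chain N (T y) &
      forall y y', C y -> C y' -> mdist y y' < d ->
        forall j, (j <= N)%N -> mdist (T y j) (T y' j) < e].

(** * Endpoints of lifted tracks *)

Definition track_end (N : nat) (T : Y -> nat -> Y) (a : E) : E := chain_lift a (T (p a)) N.

(** Consequently two points over [C] with the same track end are within twice this bound, which
    makes the nerve map uniformly cobounded. *)
Lemma track_end_dist C d N T a : sampled_contraction C d N T -> C (p a) ->
  (D a (track_end N T a) < (N.+1%:R * e)%:E)%E.
Proof. by move=> [T0 _ Tf _] Ca; apply: (chain_lift_dist (Tf _ Ca)) => //; exact: T0. Qed.

(** Both ends lie over the point to which [C] contracts, and closeness of lifts puts them less than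
    [e] apart. *)
Lemma track_end_locally_constant C d N T a b : sampled_contraction C d N T ->
  C (p a) -> C (p b) -> (D a b < d%:E)%E -> (D a b < e%:E)%E ->
  track_end N T a = track_end N T b.
Proof.
have e0 := scale_gt0.
move=> [T0 [y0 TN] Tf Td] Ca Cb Dd De.
apply: (@scale_uniq _ _ e); last by lra.
  by rewrite !(@chain_lift_fiber N) ?TN//; [exact: Tf|exact: T0|exact: Tf|exact: T0].
apply: (@chain_lift_close N) => //; [exact: Tf|exact: Tf|exact: T0|exact: T0|].
by apply: Td => //; exact: lifted_dist_mdist Dd.
Qed.

(** Lifting the reversed tracks from [z] defines a section [s] of [p] over [C]. A point whose track
    ends at [z] is recovered as [s (p a)], so the image of the compact set [C] under [s] contains
    all such points; the work is the continuity of [s]. *)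
Lemma track_end_fiber_compact C d N T z : geodesic Y -> compact [set: Y] -> covering_map p ->
  closed C -> 0 < d -> sampled_contraction C d N T ->
  exists K : set E, compact K /\ forall a, C (p a) -> track_end N T a = z -> K a.
Proof.
have e0 := scale_gt0.
move=> geo cY cov clC d0 [T0 [y0 TN] Tf Td].
have [pz|pz] := pselect (p z = y0); last first.
  exists set0; split; first exact: compact0.
  move=> a Ca az; apply: pz; rewrite -az (@chain_lift_fiber N) ?TN//.
    exact: Tf.
  exact: T0.
pose rT y j := T y (N - j)%N; pose s y := chain_lift z (rT y) N.
have rTf y : C y -> fine_chain N (rT y).
  move=> Cy j jN; rewrite /rT -(subnSK jN) metric_sym; apply: Tf => //.
  by rewrite subnSK// leq_subr.
have rT0 y : C y -> rT y 0%N = p z by move=> Cy; rewrite /rT subn0 TN.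
have ps y : C y -> p (s y) = y.
  by move=> Cy; rewrite (chain_lift_fiber (rTf _ Cy) (rT0 _ Cy))// /rT subnn T0.
exists (s @` C); split; last first.
  move=> a Ca az; exists (p a) => //; rewrite /s -az; apply: chain_lift_rev.
    exact: Tf.
  exact: T0.
apply: continuous_compact; last by apply: subclosed_compact clC cY _.
apply/subspace_continuousP => y Cy A /= nA.
change (nbhs y (fun y' => C y' -> A (s y'))).
have [r [r0 rA]] := nbhs_lifted_ball geo cY cov nA.
pose m := Num.min r (Num.min d e).
have m0 : 0 < m by rewrite !lt_min r0 d0 e0.
have mr : m <= r by rewrite ge_min lexx.
have md : m <= d by rewrite ge_min ge_min lexx orbT.
have me : m <= e by rewrite ge_min ge_min lexx !orbT.
have := nbhs_mball y m0; apply: filterS => y' yy' Cy'; apply: rA.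
(* This coarse bound only serves uniqueness: it identifies [s y'] with the lift [c] of [y'] that
   lies within [m] of [s y]. *)
have Dss : (D (s y) (s y') < e%:E)%E.
  apply: (@chain_lift_close N) => //; [exact: rTf|exact: rTf|exact: rT0|exact: rT0| |].
    by move=> j jN; apply: Td => //; [lra|exact: leq_subr].
  exact: lifted_dist_refl.
have [c [pc Dsc]] : exists c, p c = y' /\ (D (s y) c < m%:E)%E.
  by apply: scale_lift; [rewrite ps|lra].
have <- : c = s y'.
  apply: (@scale_uniq _ _ (m + e)); first by rewrite pc ps.
    by apply: lifted_dist_triangle Dss; exact: lifted_dist_sym.
  by lra.
by apply: lt_le_trans Dsc _; rewrite lee_fin.
Qed.

End ChainLifting.

(** * The uniform metric of a complex *)

Section UniformMetric.
Context {R : realType} {V : choiceType}.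
Implicit Types (x y : V -> R) (S : set {fset V}) (C : set (V -> R)).

Lemma sqrt_sum_sqr_le (s : seq V) (a : V -> R) :
  Num.sqrt (\sum_(v <- s) a v ^+ 2) <= \sum_(v <- s) `|a v|.
Proof.
have n0 : 0 <= \sum_(v <- s) `|a v| by apply: sumr_ge0.
rewrite -[leRHS]ger0_norm// -sqrtr_sqr ler_sqrt ?sqr_ge0//.
elim: s n0 => [|v s IH] _; first by rewrite !big_nil expr0n.
have n0 : 0 <= \sum_(v <- s) `|a v| by apply: sumr_ge0.
rewrite !big_cons sqrrD real_normK ?num_real// -addrA lerD2l.
by apply: le_trans (IH n0) _; rewrite lerDr mulrn_wge0// mulr_ge0.
Qed.

(** The l2 norm is bounded by the l1 norm; after exchanging sums each weight [c i], placed at the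
    vertex [w i], is counted at most once. *)
Lemma sqrt_sum_le_weights (I : finType) (w : I -> V) (c : I -> R) x y (F : {fset V}) :
  (forall i, 0 <= c i) -> (forall v, `|x v - y v| <= \sum_(i | w i == v) c i) ->
  Num.sqrt (\sum_(v <- enum_fset F) (x v - y v) ^+ 2) <= \sum_i c i.
Proof.
move=> c0 xyc; apply: le_trans (sqrt_sum_sqr_le _ _) _.
apply: (@le_trans _ _ (\sum_(v <- enum_fset F) \sum_(i | w i == v) c i)).
  by apply: ler_sum.
rewrite (exchange_big_dep xpredT)//=; apply: ler_sum => i _.
rewrite big_const_seq iter_addr_0 (eq_count (a2 := pred1 (w i))); last first.
  by move=> v /=; rewrite eq_sym.
by rewrite count_uniq_mem ?fset_uniq//; case: (_ \in _); rewrite ?mulr1n ?mulr0n.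
Qed.

Lemma l2dist_le_weights (I : finType) (w : I -> V) (c : I -> R) x y :
  (forall i, 0 <= c i) -> (forall v, `|x v - y v| <= \sum_(i | w i == v) c i) ->
  l2dist x y <= \sum_i c i.
Proof.
move=> c0 xyc; apply: ge_sup; first by eexists; exists fset0.
by move=> _ [F ->]; exact: sqrt_sum_le_weights.
Qed.

(** The supremum in [l2dist] dominates its terms only if it is taken over a bounded set; finiteness
    of both supports provides the bound. *)
Lemma coord_le_l2dist S x y v : realization S x -> realization S y ->
  `|x v - y v| <= l2dist x y.
Proof.
move=> [_ [s [_ [xs _]]]] [_ [t [_ [yt _]]]].
have Hub (F : {fset V}) : Num.sqrt (\sum_(v <- enum_fset F) (x v - y v) ^+ 2) <=
    \sum_(i : (s `|` t)%fset) `|x (val i) - y (val i)|.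
  apply: (sqrt_sum_le_weights (w := fun i : (s `|` t)%fset => val i)) => // u.
  have [ust|ust] := boolP (u \in (s `|` t)%fset).
    rewrite (bigD1 (FSetSub ust)) /= ?eqxx// lerDl; exact: sumr_ge0.
  have [-> ->] : x u = 0 /\ y u = 0.
    move: ust; rewrite in_fsetU negb_or => /andP[us ut].
    by split; apply/eqP; [move: us|move: ut]; apply: contraNT; [exact: xs|exact: yt].
  by rewrite subrr normr0; exact: sumr_ge0.
have -> : `|x v - y v| = Num.sqrt (\sum_(v <- enum_fset [fset v]%fset) (x v - y v) ^+ 2).
  by rewrite big_seq_fset1 sqrtr_sqr.
apply: ub_le_sup; last by exists [fset v]%fset.
by exists (\sum_(i : (s `|` t)%fset) `|x (val i) - y (val i)|) => _ [F ->].
Qed.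

Lemma subseq_ge (phi : nat -> nat) : (forall n, (phi n < phi n.+1)%N) ->
  forall n, (n <= phi n)%N.
Proof. by move=> Hphi; elim=> // n IH; exact: leq_ltn_trans IH (Hphi n). Qed.

(** Otherwise there are points [g n] of [C] with coordinate at least [c] at distinct vertices [u n].
    A subsequence converges to some [x] with finite support [s]; a vertex outside [s] keeps [g] at
    distance at least [c] from [x], so the late vertices, infinitely many, all lie in [s]. *)
Lemma K_compact_finite_vertices S C (c : R) : K_compact S C -> 0 < c ->
  finite_set [set v | exists x, C x /\ c <= x v].
Proof.
move=> [CS Cseq] c0; apply: contrapT => /infiniteP.
move=> /card_leP [f]; pose u (n : nat) : V := val (f (exist _ n (mem_setT n))).
have uI : injective u.
  by move=> i j /val_inj /(@inj _ _ _ f _ _ (mem_setT _) (mem_setT _)) [].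
have /choice [g gP] : forall n, exists x, C x /\ c <= x (u n).
  by move=> n; have := valP (f (exist _ n (mem_setT n))); rewrite inE.
have [phi [x [phim [Cx lim]]]] := Cseq g (fun n => (gP n).1).
have [_ [s [_ [xs _]]]] := CS _ Cx.
have [N NP] := lim c c0.
have us n : (N <= n)%N -> u (phi n) \in s.
  move=> Nn; apply: xs; apply: contraTneq (NP n Nn) => xu0.
  rewrite -leNgt; apply: le_trans (coord_le_l2dist (u (phi n)) (CS _ (gP _).1) (CS _ Cx)).
  by rewrite xu0 subr0; apply: le_trans (gP (phi n)).2 (ler_norm _).
have phimono : {homo phi : i j / (i < j)%N >-> (i < j)%N}.
  by apply: homo_ltn => //; exact: ltn_trans.
have uinj : injective (fun i => u (phi (N + i)%N)).
  move=> i j /uI phiij; case: (ltngtP i j) => // ij.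
    by have := phimono (N + i)%N (N + j)%N; rewrite ltn_add2l ij phiij ltnn => /(_ isT).
  by have := phimono (N + j)%N (N + i)%N; rewrite ltn_add2l ij phiij ltnn => /(_ isT).
pose l := [seq u (phi (N + i)%N) | i <- iota 0 #|` s|.+1].
have : (size l <= size (enum_fset s))%N.
  apply: uniq_leq_size; first by rewrite map_inj_uniq ?iota_uniq.
  by move=> v /mapP[i _ ->]; apply: us; rewrite leq_addr.
by rewrite size_map size_iota ltnn.
Qed.

(** Sequentially compact sets are closed: points of [C] tending to [x] have a subsequence with limit
    in [C], and the two limits agree in every coordinate. *)
Lemma K_compact_away S C x : K_compact S C -> realization S x -> ~ C x ->
  exists e : R, 0 < e /\ forall y, C y -> e <= l2dist x y.
Proof.
move=> [CS Cseq] Sx nCx; apply: contrapT => nex.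
have /choice [u uP] : forall n : nat, exists y, C y /\ l2dist x y < n.+1%:R^-1.
  move=> n; apply: contrapT => ny; apply: nex; exists n.+1%:R^-1.
  rewrite invr_gt0 ltr0n; split => // y Cy; rewrite leNgt; apply/negP => lt.
  by apply: ny; exists y.
have [phi [z [phim [Cz lim]]]] := Cseq u (fun n => (uP n).1).
suff E : x = z by apply: nCx; rewrite E.
apply/funext => v; apply/eqP; rewrite -subr_eq0 -normr_le0.
apply/ler_addgt0Pr => e e0; rewrite add0r.
have e20 : 0 < e / 2 by rewrite divr_gt0.
have [N NP] := lim _ e20.
have [M _ MP] := near_infty_natSinv_lt (PosNum e20).
pose n := maxn N M.
have Nn : (N <= n)%N by rewrite leq_maxl.
have Mn : (M <= phi n)%N by apply: leq_trans (subseq_ge phim n); rewrite leq_maxr.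
have h1 := le_lt_trans (coord_le_l2dist v (CS _ (uP (phi n)).1) (CS _ Cz)) (NP n Nn).
have h2 := le_lt_trans (coord_le_l2dist v Sx (CS _ (uP (phi n)).1)) (uP (phi n)).2.
have h3 : (phi n).+1%:R^-1 < e / 2 := MP _ Mn.
have := ler_distD (u (phi n) v) (x v) (z v); have := lt_trans h2 h3; lra.
Qed.

End UniformMetric.

(** * Partitions of unity and sampled contractions *)

Lemma cdisk_compact (R : realType) n : compact (@cdisk R n).
Proof.
have csq : continuous (@sqnorm R n).
  apply: continuous_big => [|i _ v]; first exact: add_continuous.
  have ci := @coord_continuous R 1 n ord0 i v.
  exact: (cvgM ci ci).
apply: (@subclosed_compact _ _ [set v : 'rV[R]_n | forall i, `[-1, 1]%classic (v ord0 i)]).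
- rewrite (_ : @cdisk R n = @sqnorm R n @^-1` [set t | t <= 1]); last by [].
  exact: (preimage_closed (fun v _ => csq v) (@closed_le R 1)).
- by apply: (@rV_compact R n (fun=> `[-1, 1]%classic)) => i; exact: segment_compact.
- move=> v; rewrite /cdisk /= => v1 i; rewrite in_itv /= -ler_norml.
  rewrite -(@expr_le1 _ 2)// real_normK ?num_real//; apply: le_trans v1.
  rewrite /sqnorm (bigD1 i)//= lerDl; apply: sumr_ge0 => j _; exact: sqr_ge0.
Qed.

Lemma finite_CW_compact (R : realType) (X : topologicalType) :
  @finite_CW R X -> compact [set: X].
Proof.
move=> [_ [m [dm [Phi [cPhi [_ [_ [cov _]]]]]]]].
rewrite (_ : [set: X] = \big[setU/set0]_(i <- enum 'I_m) (Phi i @` @cdisk R (dm i))).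
  by apply: bigsetU_compact => i _; apply: continuous_compact => //; exact: cdisk_compact.
apply/seteqP; split => // x _; rewrite -bigcup_seq /=.
have [i [v vo <-]] := cov x; exists i; first by rewrite /= mem_enum.
by exists v => //; rewrite /cdisk /=; exact: ltW.
Qed.

Section CompactMetric.
Context {R : realType} {Y : metricType R} (cY : compact [set: Y]).

(** Truncated distances to the complements are lowered by [l / 2] and cut at zero, then normalized.
    With [l] a Lebesgue number the normalizing sum is at least [l / 2], which keeps the quotients
    Lipschitz. *)
Lemma lipschitz_partition_of_unity (n : nat) (U : 'I_n -> set Y) :
  (forall i, open (U i)) -> (forall y, exists i, U i y) ->
  exists (psi : 'I_n -> Y -> R) (C : 'I_n -> set Y) (L : R),
    [/\ forall i, closed (C i), forall i, C i `<=` U i,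
        forall i y, 0 <= psi i y, forall y, \sum_i psi i y = 1 &
        (forall i y, psi i y != 0 -> C i y) /\
        (0 <= L /\ forall i x y, `|psi i x - psi i y| <= L * mdist x y)].
Proof.
move=> oU covU; have [l [l0 lP]] := lebesgue_number cY oU covU.
(* [rho i y] is the distance from [y] to the complement of [U i], truncated at [l] *)
pose A i y := [set r : R | 0 <= r <= l /\ forall z, mdist y z < r -> U i z].
pose rho i y := sup (A i y).
have A0 i y : A i y 0.
  split; first by rewrite lexx ltW.
  by move=> z; rewrite ltNge mdist_ge0.
have Aub i y : has_ubound (A i y) by exists l => r [/andP[]].
have rho0 i y : 0 <= rho i y by exact: ub_le_sup.
have rhoB i x y : rho i x <= rho i y + mdist x y.
  apply: ge_sup; first by exists 0.
  move=> r [/andP[r0 rl] rU]; have d0 := mdist_ge0 x y.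
  (* If [r] exceeds the distance, the ball about [y] of the remaining radius lies in the [r]-ball
     about [x]; otherwise [0 <= rho i y] suffices. *)
  have [rd|rd] := leP r (mdist x y); first by have := rho0 i y; lra.
  rewrite -lerBlDr; apply: ub_le_sup => //; split; first by lra.
  move=> z yz; apply: rU; apply: le_lt_trans (metric_triangle _ y _) _; lra.
have rhol y : exists i, l <= rho i y.
  have [i iP] := lP y; exists i; apply: ub_le_sup => //; split => //.
  by rewrite lexx ltW.
have rhoU i y : 0 < rho i y -> U i y.
  move=> /(sup_gt (ex_intro _ 0 (A0 i y)))[r [_ rU] r0].
  by apply: rU; rewrite mdistxx.
pose phi i y := Num.max 0 (rho i y - l / 2).
have phi0 i y : 0 <= phi i y by rewrite /phi le_max lexx.
have phiB i x y : `|phi i x - phi i y| <= mdist x y.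
  have := rhoB i x y; have := rhoB i y x; rewrite (metric_sym y x) => h1 h2.
  have := mdist_ge0 x y; rewrite /phi ler_norml.
  by case: (leP 0 (rho i x - l / 2)); case: (leP 0 (rho i y - l / 2)); lra.
pose Phi y := \sum_i phi i y.
have phile i y : phi i y <= Phi y.
  by rewrite /Phi (bigD1 i)//= lerDl; exact: sumr_ge0.
have Phil y : l / 2 <= Phi y.
  have [i il] := rhol y; apply: le_trans (phile i y).
  by rewrite /phi le_max; apply/orP; right; lra.
have Phi0 y : 0 < Phi y by apply: lt_le_trans (Phil y); rewrite divr_gt0.
have PhiB x y : `|Phi x - Phi y| <= n%:R * mdist x y.
  rewrite /Phi -sumrB; apply: le_trans (ler_norm_sum _ _ _) _.
  apply: le_trans (ler_sum _ (fun i _ => phiB i x y)) _.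
  by rewrite sumr_const card_ord mulr_natl.
exists (fun i y => phi i y / Phi y), (fun i => [set y | l / 2 <= rho i y]),
  ((1 + n%:R) / (l / 2)); split.
- move=> i; rewrite (_ : mkset _ = rho i @^-1` [set t | l / 2 <= t]); last by [].
  have crho : continuous (rho i).
    apply: (@continuous_lipschitz _ _ _ 1) => x z.
    rewrite mul1r ler_norml; have := rhoB i x z; have := rhoB i z x.
    by rewrite (metric_sym z x); lra.
  exact: (preimage_closed (fun y _ => crho y) (@closed_ge R (l / 2))).
- by move=> i y /= ly; apply: rhoU; lra.
- by move=> i y; rewrite divr_ge0// ltW.
- by move=> y; rewrite -mulr_suml divff// gt_eqF//; exact: Phi0.
split.
  move=> i y /=; apply: contraNT; rewrite -ltNge => lty.
  by rewrite /phi max_l ?mul0r//; lra.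
split; first by rewrite divr_ge0 ?addr_ge0// ltW// divr_gt0.
move=> i x y.
(* Separates the variation of the numerator, with constant [1], from that of the denominator, with
   constant [n]; each is divided by [Phi x], which is at least [l / 2]. *)
have -> : phi i x / Phi x - phi i y / Phi y =
    (phi i x - phi i y) / Phi x + (phi i y / Phi y) * ((Phi y - Phi x) / Phi x).
  have := Phi0 x; have := Phi0 y; move: (Phi x) (Phi y) => u v v0 u0.
  have vn : v != 0 by rewrite gt_eqF.
  have un : u != 0 by rewrite gt_eqF.
  by field; rewrite un vn.
apply: le_trans (ler_normD _ _) _; rewrite !normrM !normfV.
rewrite (gtr0_norm (Phi0 x)) (gtr0_norm (Phi0 y)) (ger0_norm (phi0 i y)).
have q1 : phi i y / Phi y <= 1 by rewrite ler_pdivrMr// mul1r.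
have d0 := mdist_ge0 x y.
have l20 : 0 < l / 2 by rewrite divr_gt0.
have inv : (Phi x)^-1 <= (l / 2)^-1 by rewrite lef_pV2// posrE.
apply: (@le_trans _ _ (mdist x y / (l / 2) + 1 * (n%:R * mdist x y / (l / 2)))).
  apply: lerD.
    by apply: ler_pM => //; rewrite invr_ge0 ltW.
  apply: ler_pM => //; first by rewrite divr_ge0// ltW.
    by rewrite divr_ge0// ltW.
  apply: ler_pM => //; first by rewrite invr_ge0 ltW.
  by rewrite distrC.
by rewrite mul1r -mulrDl -[X in X + _]mul1r -mulrDl mulrAC.
Qed.

(** Heine's theorem on the compact set [C]*[unitI], within which alone [H] is continuous. *)
Lemma uniformly_continuous_track (C : set Y) (H : Y * R -> Y) (e : R) :
  closed C -> {within C `*` @unitI R, continuous H} -> 0 < e ->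
  exists r : R, 0 < r /\ forall y y' t t', C y -> C y' -> unitI t -> unitI t' ->
    mdist y y' < r -> `|t - t'| < r -> mdist (H (y, t)) (H (y', t')) < e.
Proof.
move=> clC /subspace_continuousP cH e0; pose K := C `*` @unitI R.
have cK : compact K.
  apply: compact_setX; first exact: subclosed_compact clC cY _.
  by rewrite unitIE; exact: segment_compact.
move/compact_near_coveringP/near_covering_withinP: cK => cov.
pose P (r : R) (q : Y * R) := forall q', K q' -> mdist q.1 q'.1 < r ->
  `|q.2 - q'.2| < r -> mdist (H q) (H q') < e.
suff : \forall r \near (0 : R)^'+, 0 < r /\ K `<=` P r.
  move=> /filter_ex [r [r0 rP]]; exists r; split => // y y' t t' Cy Cy' It It' yy' tt'.
  exact: (rP (y, t) (conj Cy It) (y', t') (conj Cy' It')).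
apply: filterI; first exact: nbhs_right_gt.
apply: (cov R (0^'+) P _) => q Kq.
have e20 : 0 < e / 2 by rewrite divr_gt0.
have [[A B] /= [nA nB] AB] : nbhs q (fun q' => K q' -> mdist (H q) (H q') < e / 2).
  exact: (cH q Kq _ (nbhs_mball (H q) e20)).
have /metricType_numDomainType.nbhs_mdistP[/= r1 r10 r1A] : \forall y \near q.1, A y by [].
have [r2 /= r20 r2B] := nB.
pose r := Num.min r1 r2 / 2.
have r0 : 0 < r by rewrite divr_gt0// lt_min r10.
have rr1 : r + r <= r1 by rewrite -splitr ge_min lexx.
have rr2 : r + r <= r2 by rewrite -splitr ge_min lexx orbT.
exists ([set q' : Y * R | mdist q.1 q'.1 < r /\ `|q.2 - q'.2| < r], [set s | s < r]) => /=.
  split; last exact: nbhs_right_lt.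
  exists ([set y | mdist q.1 y < r], [set t | `|q.2 - t| < r]) => /=.
    by split; [exact: nbhs_mball|exists r].
  by move=> [].
move=> [q' s] /= [[q1 q2] sr] Kq' q'' Kq'' q'1 q'2.
have nAB (z : Y * R) : K z -> mdist q.1 z.1 < r1 -> `|q.2 - z.2| < r2 ->
    mdist (H q) (H z) < e / 2.
  move=> Kz z1 z2; apply: AB => //; split; first exact: r1A.
  by apply: r2B.
have h1 : mdist (H q) (H q') < e / 2 by apply: nAB => //; lra.
have h2 : mdist (H q) (H q'') < e / 2.
  apply: nAB => //.
    apply: le_lt_trans (metric_triangle _ q'.1 _) _; lra.
  apply: le_lt_trans (ler_distD q'.2 _ _) _; lra.
apply: le_lt_trans (metric_triangle _ (H q) _) _; rewrite metric_sym; lra.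
Qed.

(** The homotopy is sampled at the times [j / N.+1], with mesh below a modulus [r] of uniform
    continuity; the same [r] controls neighbouring tracks. *)
Lemma exists_sampled_contraction (e : R) (C U : set Y) : 0 < e ->
  closed C -> C `<=` U -> @contractible_in R Y U ->
  exists (d : R) N T, 0 < d /\ sampled_contraction e C d N T.
Proof.
move=> e0 clC CU [H [y0 [cH HU]]].
have cHC : {within C `*` @unitI R, continuous H}.
  by apply: continuous_subspaceW cH => -[y t] [/= /CU].
have [r [r0 rP]] := uniformly_continuous_track clC cHC e0.
have [N _ NP] := near_infty_natSinv_lt (PosNum r0).
have Nr : N.+1%:R^-1 < r := NP N (leqnn N).
have N0 : 0 < N.+1%:R :> R by rewrite ltr0n.
have tI (j : nat) : (j <= N.+1)%N -> unitI (j%:R / N.+1%:R : R).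
  by move=> jN; rewrite /unitI /= divr_ge0//= ler_pdivrMr// mul1r ler_nat.
exists r, N.+1, (fun y j => H (y, j%:R / N.+1%:R)); split => //; split.
- by move=> y /CU /HU[]; rewrite mul0r.
- by exists y0 => y /CU /HU[_]; rewrite divff// gt_eqF.
- move=> y Cy j jN; apply: rP => //; [exact/tI/ltnW|exact: tI|by rewrite mdistxx|].
  by rewrite distrC -mulrBl -natrB// subSnn mul1r ger0_norm// invr_ge0 ltW.
- move=> y y' Cy Cy' yy' j jN; apply: rP => //; [exact: tI|exact: tI|].
  by rewrite subrr normr0.
Qed.

End CompactMetric.

(** * The map to the nerve *)

Section NerveMap.
Context {R : realType} {E : choiceType} {k : nat}.
Local Notation V := ('I_k.+1 * E)%type.
Implicit Types (w : 'I_k.+1 -> E) (c : 'I_k.+1 -> R).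

(** The [k]-skeleton of the full simplex on all pairs (index, track end). It contains the nerve,
    since a point of [E] uses one vertex per index. *)
Definition skeleton : set {fset V} := [set s | s != fset0 /\ (#|` s| <= k.+1)%N].

Lemma skeleton_simplicial : simplicial_complex skeleton.
Proof.
split; first by move=> s [].
by move=> s t [_ ks] ts t0; split => //; apply: leq_trans ks; exact: fsubset_leq_card.
Qed.

(** The formal sum of the vertices [(i, w i)] with weights [c i]. *)
Definition nerve_point w c : V -> R := fun v => if v.2 == w v.1 then c v.1 else 0.

Lemma nerve_point_at w c i : nerve_point w c (i, w i) = c i.
Proof. by rewrite /nerve_point eqxx. Qed.

Lemma nerve_point_realization w c : (forall i, 0 <= c i) -> \sum_i c i = 1 ->
  realization skeleton (nerve_point w c).
Proof.
move=> c0 c1; split; first by move=> v; rewrite /nerve_point; case: ifP.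
pose s : {fset V} := [fset v in [seq (i, w i) | i <- enum 'I_k.+1]]%fset.
have winj : injective (fun i => (i, w i)) by move=> i j [].
have us : uniq [seq (i, w i) | i <- enum 'I_k.+1] by rewrite map_inj_uniq ?enum_uniq.
have ps : perm_eq (enum_fset s) [seq (i, w i) | i <- enum 'I_k.+1].
  by apply: uniq_perm; rewrite ?fset_uniq// => v; rewrite inE.
exists s; split; last split.
- split; last by rewrite /= (perm_size ps) size_map size_enum_ord.
  by rewrite -cardfs_gt0 /= (perm_size ps) size_map size_enum_ord.
- move=> [i z]; rewrite /nerve_point /=; case: (z =P w i) => [-> _|]; last by rewrite eqxx.
  rewrite inE.
  by apply/mapP; exists i; rewrite ?mem_enum.
- rewrite (perm_big _ ps) big_map big_enum /= -c1; apply: eq_bigr => i _.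
  exact: nerve_point_at.
Qed.

(** Each point has l1 norm one. This bound handles points of [E] that are far apart, whose vertices
    may differ. *)
Lemma nerve_point_l2dist_le2 w c w' c' : (forall i, 0 <= c i) -> \sum_i c i = 1 ->
  (forall i, 0 <= c' i) -> \sum_i c' i = 1 ->
  l2dist (nerve_point w c) (nerve_point w' c') <= 2.
Proof.
move=> c0 c1 c'0 c'1.
pose W (q : 'I_k.+1 + 'I_k.+1) : V := match q with inl i => (i, w i) | inr i => (i, w' i) end.
pose K (q : 'I_k.+1 + 'I_k.+1) : R := match q with inl i => c i | inr i => c' i end.
have -> : 2 = \sum_q K q by rewrite big_sumType /= c1 c'1.
apply: (l2dist_le_weights (w := W)); first by case.
move=> [i z]; rewrite big_sumType /=; apply: le_trans (ler_normB _ _) _.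
have H (u : 'I_k.+1 -> E) (a : 'I_k.+1 -> R) : (forall i, 0 <= a i) ->
    `|nerve_point u a (i, z)| <= \sum_(j | (j, u j) == (i, z)) a j.
  move=> a0; rewrite /nerve_point /=; case: eqP => [->|_].
    by rewrite (bigD1 i)//= ger0_norm// lerDl; apply: sumr_ge0.
  by rewrite normr0; exact: sumr_ge0.
by apply: lerD; exact: H.
Qed.

Lemma nerve_point_l2dist_le w c w' c' : (forall i, c i != 0 -> c' i != 0 -> w i = w' i) ->
  l2dist (nerve_point w c) (nerve_point w' c') <= \sum_i `|c i - c' i|.
Proof.
(* A common choice of vertices: wherever either weight at [i] is nonzero, it sits at [(i, u i)]. *)
move=> ww'; pose u i := if c i == 0 then w' i else w i.
apply: (l2dist_le_weights (w := fun i => (i, u i))) => //.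
move=> [i z]; have [uz|uz] := eqVneq (u i) z.
  rewrite (bigD1 i) /= ?uz//; apply: (@le_trans _ _ `|c i - c' i|); last first.
    by rewrite lerDl; apply: sumr_ge0.
  rewrite /nerve_point /= -uz /u; have [c0|c0] := eqVneq (c i) 0.
    by rewrite c0 eqxx; case: ifP.
  rewrite eqxx; case: eqP => // wi; have [->//|c'0] := eqVneq (c' i) 0.
  by exfalso; exact/wi/ww'.
suff -> : nerve_point w c (i, z) - nerve_point w' c' (i, z) = 0.
  by rewrite normr0; exact: sumr_ge0.
move: uz; rewrite /nerve_point /= /u; have [c0|c0] := eqVneq (c i) 0.
  by rewrite c0 [z == w' i]eq_sym => /negbTE ->; case: ifP; rewrite subr0.
rewrite [z == w i]eq_sym => wz; rewrite (negbTE wz).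
case: eqP => [zw|_]; last by rewrite subr0.
have [->|c'0] := eqVneq (c' i) 0; first by rewrite subr0.
by move: wz; rewrite zw (ww' i c0 c'0) eqxx.
Qed.

End NerveMap.

(** * The two inequalities between the dimensions *)

Lemma dim_MC_le_dim_mc_le (R : realType) (E : topologicalType) (d : E -> E -> \bar R) k :
  dim_MC_le d k -> dim_mc_le d k.
Proof.
by move=> [V [S [f [sS [dS [fS [cf [uf _]]]]]]]]; exists V, S, f; do !split => //.
Qed.

Lemma cat_le_dim_MC_le (R : realType) (Y : metricType R) (E : topologicalType)
    (p : E -> Y) (k : nat) :
  compact [set: Y] -> geodesic Y -> covering_map p -> @cat_le R Y k ->
  dim_MC_le (lifted_dist p) k.
Proof.
move=> cY geo cov [U [oU [ctrU covU]]].
have [psi [C [L [clC CU psi0 psi1 [psiC [L0 psiL]]]]]] :=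
  lipschitz_partition_of_unity cY oU covU.
have [e se] := exists_lifting_scale geo cY cov; have e0 := scale_gt0 se.
have /choice [d_ /choice [N_ /choice [T_ sampled]]] : forall i, exists d, exists N, exists T,
    0 < d /\ sampled_contraction e (C i) d N T.
  move=> i; have [d [N [T dT]]] := exists_sampled_contraction cY e0 (clC i) (@CU i) (ctrU i).
  by exists d, N, T.
have dpos i := (sampled i).1; have smp i := (sampled i).2.
have [d [d0 de dd]] : exists d : R, [/\ 0 < d, d <= e & forall i, d <= d_ i].
  have : \forall d \near (0 : R)^'+, (0 < d /\ d <= e) /\ forall i, d <= d_ i.
    apply: filterI; first by apply: filterI; [exact: nbhs_right_gt|exact: nbhs_right_le].
    apply: (@filter_forall _ _ (fun i => [set d | d <= d_ i]) (0^'+) _) => i.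
    exact: nbhs_right_le.
  by move=> /filter_ex[d [[d0 de] dd]]; exists d.
pose w a i := track_end p e (N_ i) (T_ i) a.
pose c a i := psi i (p a).
pose f a := nerve_point (w a) (c a).
have c0 a i : 0 <= c a i by exact: psi0.
have c1 a : \sum_i c a i = 1 by exact: psi1.
have fS a : realization skeleton (f a) by exact: nerve_point_realization.
(* Below the common scale [d], points have equal track ends wherever both weights are nonzero, so
   only the weights vary. *)
have fnear a b : (lifted_dist p a b < d%:E)%E ->
    l2dist (f a) (f b) <= k.+1%:R * L * mdist (p a) (p b).
  move=> Dab; apply: (@le_trans _ _ (\sum_i `|c a i - c b i|)).
    apply: nerve_point_l2dist_le => i ca cb.
    apply: (track_end_locally_constant se (smp i)); try exact: psiC.
      by apply: lt_le_trans Dab _; rewrite lee_fin.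
    by apply: lt_le_trans Dab _; rewrite lee_fin.
  apply: le_trans (ler_sum _ (fun i _ => psiL i _ _)) _.
  by rewrite sumr_const card_ord -[leLHS]mulr_natl mulrA.
have cf : K_continuous f.
  move=> a s s0; pose M := k.+1%:R * L + 1.
  have M0 : 0 < M by rewrite ltr_wpDl// mulr_ge0.
  have m0 : 0 < Num.min d (s / M) by rewrite lt_min d0 divr_gt0.
  have := lifted_ball_nbhs geo cY cov a m0; apply: filterS => b Dab.
  have Dd : (lifted_dist p a b < d%:E)%E.
    by apply: lt_le_trans Dab _; rewrite lee_fin ge_min lexx.
  apply: le_lt_trans (fnear _ _ Dd) _.
  have := lifted_dist_mdist Dab; rewrite lt_min ltr_pdivlMr// => /andP[_].
  apply: le_lt_trans; rewrite mulrC ler_wpM2l ?mdist_ge0// /M; lra.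
exists ('I_k.+1 * E)%type, skeleton, f.
split; first exact: skeleton_simplicial.
split; first by move=> s [].
split => //; split => //; split; last split.
(* Summing over all indices gives a bound independent of the index at which the weight is nonzero;
   the added [1] makes it strict and positive. *)
- pose B := \sum_i 2 * ((N_ i).+1%:R * e).
  have B0 : 0 <= B by apply: sumr_ge0 => i _; rewrite !mulr_ge0// ltW.
  exists (B + 1); split; first by rewrite ltr_wpDl.
  move=> z; apply: (@le_lt_trans _ _ B%:E); last by rewrite lte_fin ltrDl.
  apply: ge_ereal_sup => _ [a [b [/= fa [fb ->]]]].
  have [i ci] : exists i, c a i != 0.
    apply: contrapT => H; have := c1 a; rewrite big1 => [/esym/eqP|i _].
      by rewrite oner_eq0.
    by apply: contrapT => /eqP ci; apply: H; exists i.
  have Ca : C i (p a) by exact: psiC.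
  (* Equal images have the same nonzero coordinate at [(i, w a i)], which forces [w b i] to be the
     same track end. *)
  have := nerve_point_at (w a) (c a) i; rewrite -/(f a) fa -fb /f /nerve_point /=.
  case: eqP => [wab cba|_ E0]; last by move: ci; rewrite -E0 eqxx.
  have Cb : C i (p b) by apply: psiC; rewrite -/(c b i) cba.
  have Da := track_end_dist se (smp i) Ca; have Db := track_end_dist se (smp i) Cb.
  have := lifted_dist_triangle Da (lifted_dist_sym _); rewrite -/(w a i) wab => /(_ _ _ Db).
  move=> /ltW Dab; apply: le_trans Dab _; rewrite lee_fin -mulr2n -[leLHS]mulr_natl.
  by rewrite /B (bigD1 i)//= lerDl; apply: sumr_ge0 => j _; rewrite !mulr_ge0// ltW.
(* The first term serves distances below [d]; from [d] on, the second one gives at least [2], which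
   bounds every distance between image points. *)
- pose M := k.+1%:R * L + 2 / d.
  have kL : 0 <= k.+1%:R * L by rewrite mulr_ge0.
  have d2 : 0 < 2 / d by rewrite divr_gt0.
  have M0 : 0 <= M by rewrite /M; lra.
  exists M; split => // a b.
  have [Dab|Dab] := ltP (lifted_dist p a b) d%:E.
    apply: (@le_trans _ _ (M%:E * (mdist (p a) (p b))%:E)%E).
      rewrite -EFinM lee_fin; apply: le_trans (fnear _ _ Dab) _.
      by rewrite ler_wpM2r ?mdist_ge0// /M; lra.
    by apply: lee_wpmul2l; rewrite ?lee_fin//; exact: mdist_le_lifted_dist.
  apply: (@le_trans _ _ (M%:E * d%:E)%E); last by apply: lee_wpmul2l; rewrite ?lee_fin.
  rewrite -EFinM lee_fin; apply: (@le_trans _ _ 2); first exact: nerve_point_l2dist_le2.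
  by rewrite /M mulrDl divfK ?gt_eqF// lerDr mulr_ge0// ltW.
- move=> Q cQ.
  (* Among [k.+1] weights of sum one, some weight is at least [k.+1%:R^-1]. Only finitely many
     vertices carry such a coordinate on [Q], so the closed preimage of [Q] lies in a finite union
     of compact sets. *)
  have k0 : 0 < k.+1%:R^-1 :> R by rewrite invr_gt0 ltr0n.
  have /finite_fsetP[F FE] := K_compact_finite_vertices cQ k0.
  have /choice [K KP] : forall v : 'I_k.+1 * E, exists K : set E, compact K /\
      forall a, C v.1 (p a) -> w a v.1 = v.2 -> K a.
    move=> [i z] /=.
    have [K [cK KP]] := track_end_fiber_compact se z geo cY cov (clC i) (dpos i) (smp i).
    by exists K; split => // a; exact: KP.
  apply: (@subclosed_compact _ _ (\big[setU/set0]_(v <- enum_fset F) K v)).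
  + rewrite -[X in closed X]setCK; apply: open_closedC; rewrite openE => a nQ.
    have [s [s0 sQ]] := K_compact_away cQ (fS a) nQ.
    have := cf a s s0; apply: filterS => b lt Qb.
    by have := sQ _ Qb; rewrite leNgt lt.
  + by apply: bigsetU_compact => v _; case: (KP v).
  + move=> a Qa; rewrite -bigcup_seq /=.
    have [i ci] : exists i, k.+1%:R^-1 <= c a i.
      apply: contrapT => H; have : \sum_i c a i < \sum_(i < k.+1) k.+1%:R^-1.
        apply: ltr_sum; first by apply/hasP; exists ord0; rewrite ?mem_index_enum.
        by move=> i _; rewrite ltNge; apply/negP => ci; apply: H; exists i.
      by rewrite c1 sumr_const card_ord -[X in _ < X]mulr_natl divff ?ltxx// pnatr_eq0.
    exists (i, w a i).
      have : [set v | exists x, Q x /\ k.+1%:R^-1 <= x v] (i, w a i).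
        by exists (f a); split => //; rewrite /f nerve_point_at.
      by rewrite FE.
    apply: (KP (i, w a i)).2 => //; apply: psiC.
    by rewrite gt_eqF//; exact: lt_le_trans ci.
Qed.

(* dim_mc(Yt) <= dim_MC(Yt) <= cat(Y), stated via the (upward-closed)
   predicates "dim <= k":  min{k | MC k} >= min{k | mc k} and
   min{k | cat k} >= min{k | MC k}. *)
Theorem theorem7p18 (R : realType) (Y : metricType R) (Yt : topologicalType)
  (p : Yt -> Y) :
  @finite_CW R Y -> geodesic Y -> @universal_cover R Yt Y p ->
  (forall k : nat, dim_MC_le (lifted_dist p) k -> dim_mc_le (lifted_dist p) k) /\
  (forall k : nat, @cat_le R Y k -> dim_MC_le (lifted_dist p) k).
Proof.
move=> cwY geo [cov _]; split => k; first exact: dim_MC_le_dim_mc_le.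
by apply: cat_le_dim_MC_le => //; exact: finite_CW_compact cwY.
Qed.
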